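(* Let $(V,\{\,,\,,\,\},\langle\,,\,\rangle,(\,,\,))$ be a finite dimensional $3D$-fluid algebra with curl operator $D$. Let $X(t)\in V$ be a solution, defined on some time interval, of the Euler equation of the fluid algebra, i.e. $\left(\frac{dX}{dt},Z\right)=\{X,DX,Z\}$ for all $Z\in V$. Then the energy $(X(t),X(t))$ and the helicity $(X(t),DX(t))$ are each constant in $t$.
   Context: A finite dimensional $3D$-fluid algebra is a finite dimensional real vector space $V$ with three structures: (1) an alternating trilinear form $\{\,,\,,\,\}$ on $V$ (triple intersection form); (2) a symmetric nondegenerate bilinear form $\langle\,,\,\rangle$ on $V$ (vorticity linking form); (3) a positive definite inner product $(\,,\,)$ on $V$ (metric). The curl operator $D:V\to V$ is the linear operator defined by $(DX,Y)=\langle X,Y\rangle$ for all $X,Y\in V$. *)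

(* Defs.v *)
From HB Require Import structures.
From mathcomp Require Import all_boot all_order all_algebra.
From mathcomp Require Import all_classical all_reals all_analysis.

Set Implicit Arguments.
Unset Strict Implicit.
Unset Printing Implicit Defensive.

Import Order.TTheory GRing.Theory Num.Theory.
Import numFieldNormedType.Exports.
Local Open Scope classical_set_scope.
Local Open Scope ring_scope.

Definition trilinear (R : realType) (V : vectType R)
    (f : V -> V -> V -> R) : Prop :=
  [/\ forall y z, scalar (fun x => f x y z),
      forall x z, scalar (fun y => f x y z) &
      forall x y, scalar (fun z => f x y z)].

Definition alternating (R : realType) (V : vectType R)
    (f : V -> V -> V -> R) : Prop :=
  forall x y, [/\ f x x y = 0, f x y x = 0 & f y x x = 0].

Record fluid_algebra (R : realType) (V : vectType R) := FluidAlgebra {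
  triple : V -> V -> V -> R;
  linking : {symmetric V};
  metric : {dot V for idfun};
  triple_linear : trilinear triple;
  triple_alternating : alternating triple;
  linking_nondegenerate : nondegenerate linking }.

Definition is_curl (R : realType) (V : vectType R) (A : fluid_algebra V)
    (D : 'End(V)) : Prop :=
  forall X Y, metric A (D X) Y = linking A X Y.

Lemma curl_exists_unique (R : realType) (V : vectType R)
  (A : fluid_algebra V) : exists! D : 'End(V), is_curl A D.
Proof.
pose e := vbasis {:V}.
pose G (f : V -> V -> R) X := \sum_(i < \dim {:V}) f X e`_i *: e`_i.
have Glin (f : V -> V -> R) : (forall y, scalar (f^~ y)) -> linear (G f).
  move=> fl a X Y; rewrite /G scaler_sumr -big_split /=.
  by apply: eq_bigr => i _; rewrite fl scalerDl scalerA.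
have ext (f g : {symmetric V}) X Y : G f X = G g Y -> f X =1 g Y.
  move=> h Z; rewrite (coord_vbasis (memvf Z)) !linear_sumr /=.
  apply: eq_bigr => i _; rewrite !linearZr_LR /=; congr (_ * _).
  have fe : free e := basis_free (vbasisP _).
  have := congr1 (coord e i) h.
  by rewrite /G !(coord_sum_free _ _ fe).
have inj X Y : metric A X =1 metric A Y -> X = Y.
  move=> h; apply/eqP; rewrite -subr_eq0; apply/negPn/negP => ne.
  have := neq0_dnorm_gt0 (s := metric A) _ ne.
  by rewrite linearBl /= h subrr ltxx.
have ml : linear (G (metric A)) by apply: Glin => y a u v; rewrite linearPl.
have ll : linear (G (linking A)) by apply: Glin => y a u v; rewrite linearPl.
pose Ml : {linear V -> V} := HB.pack (G (metric A))
  (GRing.isLinear.Build _ _ _ _ (G (metric A)) ml).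
pose Nl : {linear V -> V} := HB.pack (G (linking A))
  (GRing.isLinear.Build _ _ _ _ (G (linking A)) ll).
have kM : lker (linfun Ml) == 0%VS.
  by apply/lker0P => X Y; rewrite !lfunE /= => /ext/inj.
exists ((linfun Ml)^-1 \o linfun Nl)%VF; split.
  move=> X; apply: ext.
  rewrite -[LHS]/(Ml _) -(lfunE Ml) comp_lfunE (lker0_lfunVK kM).
  by rewrite lfunE.
move=> D' h; apply/lfunP => X; apply/inj => Z; rewrite h; apply: ext.
rewrite -[LHS]/(Ml _) -(lfunE Ml) comp_lfunE (lker0_lfunVK kM).
by rewrite lfunE.
Qed.

(* One-sided at the endpoints of J that belong to J.  The limit is taken for the
   norm of the metric; in finite dimension this is the usual topology. *)
Definition derives_to (R : realType) (V : vectType R) (A : fluid_algebra V)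
    (J : set R) (X : R -> V) (t : R) (v : V) : Prop :=
  let norm u := Num.sqrt (metric A u u) in
  norm ((s - t)^-1 *: (X s - X t) - v) @[s --> within J t^'] --> (0 : R).

Definition euler_solution (R : realType) (V : vectType R)
    (A : fluid_algebra V) (D : 'End(V)) (J : set R) (X : R -> V) : Prop :=
  forall t, J t -> exists2 v : V, derives_to A J X t v &
    forall Z, metric A v Z = triple A (X t) (D (X t)) Z.

(* Main.v *)
(* Both energy and helicity have the form [B (X t) (X t)], with [B] the metric or the
   vorticity linking form.  The derivative is [2 B(X', X)], that is [2 {X, DX, X}]
   respectively [2 (X', DX) = 2 {X, DX, DX}], and both vanish since the triple form
   alternates. *)
From HB Require Import structures.
Require Import Defs.
From mathcomp Require Import all_boot all_order all_algebra.
From mathcomp Require Import all_classical all_reals all_analysis.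
From mathcomp Require Import ring lra.

Set Implicit Arguments.
Unset Strict Implicit.
Unset Printing Implicit Defensive.

Import Order.TTheory GRing.Theory Num.Theory.
Import numFieldNormedType.Exports.
Local Open Scope classical_set_scope.
Local Open Scope ring_scope.

(** The mean value theorem applies on [[s, t]], which lies in [J]: the derivative is zero inside and
    [f] is continuous up to the ends. *)
Lemma interval_cst_of_slope_cvg0 (R : realType) (J : set R) (f : R -> R) :
  is_interval J ->
  (forall t, J t ->
    (s - t)^-1 * (f s - f t) @[s --> within J t^'] --> (0 : R)) ->
  forall s t, J s -> J t -> f s = f t.
Proof.
move=> Jitv f0 s t Js Jt.
wlog st : s t Js Jt / s < t => [wl|].
  by case: (ltgtP s t) => [||->//] h; [|symmetry]; apply: wl.
have stJ x : s <= x <= t -> J x by apply: Jitv.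
suff [c _] : exists2 c, c \in `]s, t[%R & f t - f s = 0 * (t - s).
  by rewrite mul0r => /eqP; rewrite subr_eq0 => /eqP.
apply: (@MVT R f (cst 0)) => // [x|].
  rewrite in_itv /= => /andP[sx xt].
  (* At a point inside []s, t[] the limit within [J] is two-sided: the minimum chosen as radius
     keeps [h + x] between [s] and [t]. *)
  have shift_cvg : h + x @[h --> (0 : R)^'] --> within J x^'.
    move=> P /nbhs_ballP[e /= e0 xeP].
    have d0 : 0 < Num.min e (Num.min (x - s) (t - x)).
      by rewrite !lt_min e0 !subr_gt0 sx.
    apply/nbhs_ballP; exists (Num.min e (Num.min (x - s) (t - x))) => //= h.
    rewrite /ball /= sub0r normrN !lt_min => /and3P[he hs ht] h0.
    apply: xeP => /=.
    - by rewrite /ball /= opprD addrCA subrr addr0 normrN.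
    - by rewrite -subr_eq0 addrK.
    - apply: stJ; move: hs ht; rewrite !ltr_norml.
      by move=> /andP[? ?] /andP[? ?]; lra.
  have Jx : J x by apply: stJ; rewrite !ltW.
  have quot : h^-1 *: (f (h *: (1 : R) + x) - f x) @[h --> (0 : R)^'] --> (0 : R).
    have := cvg_comp _ _ shift_cvg (f0 x Jx).
    apply: cvg_trans; apply: near_eq_cvg; near=> h => /=.
    by rewrite addrK /GRing.scale /= mulr1.
  split; first by apply/cvg_ex; exists 0; exact: quot.
  exact: cvg_lim quot.
apply/subspace_continuousP => x; rewrite /= in_itv /= => xst.
apply/cvgrPdist_lt => e e0.
(* Any bound would do in place of [1]: bounded slopes give continuity, also at an end where [J] may
   reach to one side only. *)
have /cvgrPdist_lt/(_ 1 ltr01) := f0 x (stJ _ xst).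
rewrite !near_withinE => slope; near=> y => yst.
have [->|yx] := eqVneq y x; first by rewrite subrr normr0.
have : `|0 - (y - x)^-1 * (f y - f x)| < 1.
  have Jy : J y by apply: stJ; move: yst; rewrite /= in_itv.
  by move: yx Jy; near: y.
have yx0 : 0 < `|y - x| by rewrite normr_gt0 subr_eq0.
rewrite sub0r normrN normrM normfV mulrC ltr_pdivrMr // mul1r distrC.
move=> /lt_trans; apply; rewrite distrC; near: y.
by apply/nbhs_ballP; exists e => //= z; rewrite /ball.
Unshelve. all: by end_near. Qed.

Lemma symmetric_formDZ (R : fieldType) (V : lmodType R) (B : {symmetric V})
    u h w :
  B (u + h *: w) (u + h *: w) = B u u + h * (2 * B u w + h * B w w).
Proof.
rewrite linearDl !linearDr /= !linearZl_LR !linearZr_LR /= /GRing.scale /=.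
rewrite (_ : B w u = B u w); last by rewrite hermC expr0 mul1r.
by ring.
Qed.

Section DotReal.
Variables (R : realType) (V : vectType R) (m : {dot V for idfun}).

Let nm u := Num.sqrt (m u u).

Lemma dot_ge0 u : 0 <= m u u.
Proof.
have [->|u0] := eqVneq u 0; first by rewrite linear0l.
by apply/ltW/neq0_dnorm_gt0.
Qed.

Lemma dotC u w : m u w = m w u.
Proof. by rewrite hermC expr0 mul1r. Qed.

Lemma dot_Cauchy_Schwarz u w : `|m u w| <= nm u * nm w.
Proof.
rewrite /nm -sqrtrM ?dot_ge0 // -[`|_|]sqrtr_sqr ler_wsqrtr //.
have [->|w0] := eqVneq w 0; first by rewrite !linear0r expr0n.
have ww : 0 < m w w by apply: neq0_dnorm_gt0.
(* The square of this vector is [m w w * (m u u * m w w - m u w ^+ 2)], so its sign gives the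
   inequality. *)
have := dot_ge0 (m w w *: u - m u w *: w).
rewrite linearBl !linearBr /= !linearZl_LR !linearZr_LR /= (dotC w u).
rewrite /GRing.scale /= => zz; rewrite -subr_ge0 -(pmulr_rge0 _ ww).
by move: zz; congr (_ <= _); ring.
Qed.

(* The map [u |-> \sum_i m u e_i *: e_i] is invertible, so the coordinates of [u]
   can be taken to be the numbers [m u e_i], each bounded by [nm u * nm e_i]. *)
Lemma symmetric_form_bounded (B : {symmetric V}) :
  exists C : R, forall u, `|B u u| <= C * m u u.
Proof.
pose e := vbasis {:V}.
pose G u := \sum_(i < \dim {:V}) m u e`_i *: e`_i.
have Glin : linear G.
  move=> a u w; rewrite /G scaler_sumr -big_split /=.
  by apply: eq_bigr => i _; rewrite linearPl /= scalerDl scalerA.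
pose Gl : {linear V -> V} := HB.pack G (GRing.isLinear.Build _ _ _ _ G Glin).
have Gker : lker (linfun Gl) == 0%VS.
  apply/eqP/eqP; rewrite -subv0; apply/subvP => u.
  rewrite memv_ker lfunE memv0 /= => /eqP Gu0.
  (* If [G u = 0], freeness of [e] kills every [m u e_i], hence [m u u], against definiteness. *)
  apply/negPn/negP => /(@neq0_dnorm_gt0 _ _ _ m).
  suff -> : m u u = 0 by rewrite ltxx.
  rewrite {2}(coord_vbasis (memvf u)) linear_sumr big1 // => i _.
  rewrite linearZr_LR /=.
  have := congr1 (coord e i) Gu0.
  rewrite /G (coord_sum_free _ _ (basis_free (vbasisP _))) linear0 => ->.
  exact: mulr0.
(* The basis dual to [e] with respect to [m]. *)
pose g i := (linfun Gl)^-1%VF e`_i.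
have uE u : u = \sum_(i < \dim {:V}) m u e`_i *: g i.
  rewrite -[LHS](lker0_lfunK Gker) lfunE /= /G linear_sum.
  by apply: eq_bigr => i _; rewrite linearZ.
exists (\sum_(i < \dim {:V}) \sum_(j < \dim {:V})
          nm e`_i * nm e`_j * `|B (g i) (g j)|).
move=> u; rewrite {1 2}(uE u) linear_sumlz mulr_suml.
apply: le_trans (ler_norm_sum _ _ _) _; apply: ler_sum => i _.
rewrite linear_sumr mulr_suml.
apply: le_trans (ler_norm_sum _ _ _) _; apply: ler_sum => j _.
rewrite linearZl_LR linearZr_LR /= !normrM -[m u u]sqr_sqrtr ?dot_ge0 //.
rewrite -/(nm u) [leRHS](_ : _ =
  (nm u * nm e`_i) * (nm u * nm e`_j * `|B (g i) (g j)|)); last by ring.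
by rewrite !ler_pM ?mulr_ge0 ?dot_Cauchy_Schwarz.
Qed.

End DotReal.

(* The slope of [B (X t) (X t)] between [t] and [s] is
   [2 B(v, X t) + 2 B(r, X t) + (s - t) B(v + r, v + r)], with [r] the difference
   between the slope of [X] and [v]; the first term vanishes. *)
Lemma quadratic_slope_cvg0 (R : realType) (V : vectType R) (A : fluid_algebra V)
    (J : set R) (X : R -> V) (B : {symmetric V}) (D : V -> V) t v :
  (forall u w, B u w = metric A (D u) w) ->
  derives_to A J X t v -> B v (X t) = 0 ->
  (s - t)^-1 * (B (X s) (X s) - B (X t) (X t)) @[s --> within J t^'] --> (0 : R).
Proof.
move=> BD dX Bv0.
pose nm u := Num.sqrt (metric A u u).
pose r s := (s - t)^-1 *: (X s - X t) - v.
(* Cauchy-Schwarz handles [B u (r s)] for fixed [u], but [B (r s) (r s)] would bring in [D (r s)];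
   the constant [C] bounds it instead. *)
have [C BC] := symmetric_form_bounded (metric A) B.
have BC' u : `|B u u| <= C * nm u ^+ 2 by rewrite sqr_sqrtr ?dot_ge0.
have Bs u w : B u w = B w u by rewrite hermC expr0 mul1r.
pose bnd s := 2 * (nm (D (X t)) * nm (r s)) +
   `|s - t| * (`|B v v| + 2 * (nm (D v) * nm (r s)) + C * nm (r s) ^+ 2).
have bnd0 : bnd s @[s --> within J t^'] --> (0 : R).
  have r0 : nm (r s) @[s --> within J t^'] --> (0 : R) by exact: dX.
  have d0 : `|s - t| @[s --> within J t^'] --> (0 : R).
    have : `|s - t| @[s --> t] --> `|t - t|.
      by apply: cvg_norm; apply: cvgB; [exact: cvg_id|exact: cvg_cst].
    rewrite subrr normr0; apply: cvg_trans; apply: cvg_app.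
    exact: cvg_trans (cvg_within _) (cvg_within _).
  (* The limit is written as [bnd] with [nm (r s)] and [|s - t|] replaced by [0], to match the limit
     rules term by term. *)
  have -> : 0 = 2 * (nm (D (X t)) * 0) +
     0 * (`|B v v| + 2 * (nm (D v) * 0) + C * (0 * 0)) :> R by ring.
  apply: cvgD; first by do 2!apply: cvgMl_tmp.
  apply: cvgM => //; apply: cvgD; last by apply: cvgMl_tmp; exact: cvgM.
  by apply: cvgD; [exact: cvg_cst|do 2!apply: cvgMl_tmp].
apply/cvgr0Pnorm_le => e e0.
near=> s.
have st : s - t != 0.
  rewrite subr_eq0; near: s; apply: cvg_within; rewrite nbhs_filterE.
  exact: withinT.
have -> : (s - t)^-1 * (B (X s) (X s) - B (X t) (X t)) =
    2 * B (X t) (r s) + (s - t) * (B v v + 2 * B v (r s) + B (r s) (r s)).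
  have -> : X s = X t + (s - t) *: (v + r s).
    by rewrite /r [v + _]addrC subrK scalerA divff // scale1r addrC subrK.
  (* Expansion along [v + r s] with factor [s - t], then of the square of [v + r s] with factor
     [1]. *)
  rewrite symmetric_formDZ -{2 3}[r s]scale1r symmetric_formDZ.
  have -> : B (X t) (v + r s) = B (X t) (r s).
    by rewrite linearDr /= Bs Bv0 add0r.
  by field.
apply: (@le_trans _ _ (bnd s)); last first.
  near: s; have /cvgr0Pnorm_le/(_ e e0) := bnd0.
  apply: filterS => s; apply: le_trans; exact: ler_norm.
have BDn u : `|B u (r s)| <= nm (D u) * nm (r s).
  by rewrite BD; apply: dot_Cauchy_Schwarz.
rewrite (le_trans (ler_normD _ _))// lerD//.
  by rewrite normrM ger0_norm// ler_wpM2l.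
rewrite normrM ler_wpM2l// (le_trans (ler_normD _ _))// lerD//.
rewrite (le_trans (ler_normD _ _))// lerD//.
by rewrite normrM ger0_norm// ler_wpM2l.
Unshelve. all: by end_near. Qed.

Theorem proposition1p1 (R : realType) (V : vectType R) (A : fluid_algebra V)
    (D : 'End(V)) (J : set R) (X : R -> V) :
  is_curl A D -> is_interval J -> euler_solution A D J X ->
  (forall s t : R, J s -> J t -> metric A (X s) (X s) = metric A (X t) (X t)) /\
  (forall s t : R, J s -> J t ->
     metric A (X s) (D (X s)) = metric A (X t) (D (X t))).
Proof.
move=> DA Jitv euler; have alt := @triple_alternating _ _ A.
split.
  apply: interval_cst_of_slope_cvg0 => // t /euler[v dX vE].
  apply: (quadratic_slope_cvg0 (D := id)) dX _ => //.
  by rewrite [LHS]vE; have [] := alt (X t) (D (X t)).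
(* Helicity becomes the quadratic form of [linking A], which the curl represents in the metric. *)
move=> s t Js Jt; rewrite !(dotC _ _ (D _)) !DA; move: s t Js Jt.
apply: interval_cst_of_slope_cvg0 => // t /euler[v dX vE].
apply: (quadratic_slope_cvg0 (D := D)) dX _ => //.
rewrite hermC expr0 mul1r /= -DA dotC vE.
by have [] := alt (D (X t)) (X t).
Qed.
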